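(* Let $q$ denote the cardinality of the residue field $k_F$, and let $K_{q-1}$ denote the kernel of the map $\widehat T(\mathbb C)\to\widehat T(\mathbb C)$, $\kappa\mapsto\kappa^{q-1}$. The group of depth-zero endoscopic elements is $K_{q-1}$; that is, for $\kappa\in\widehat T(\mathbb C)$ there is $\chi\in T(k_F)^\vee$ such that $\kappa=\kappa_\chi$ if and only if $\kappa\in K_{q-1}$.
   Context: $F$ is a non-archimedean local field with ring of integers $\mathcal O_F$ and residue field $k_F$; $T$ is a split torus over $F$ (a split maximal torus in a split connected reductive group $G$ with connected center), regarded over $\mathcal O_F$; $\widehat T$ is the dual torus over $\mathbb C$, so $X^*(\widehat T)=X_*(T)$. $T(k_F)^\vee$ is the set of depth-zero characters of $T(\mathcal O_F)$: smooth characters $\chi:T(\mathcal O_F)\to\mathbb C^\times$ that factor through $T(k_F)$. $W_F$ is the Weil group, $I_F$ its inertia subgroup, $\tau_F:W_F\to F^\times$ the reciprocity map of local class field theory (it maps $I_F$ onto $\mathcal O_F^\times$). For a character $\tilde\chi:T(F)\to\mathbb C^\times$, its Langlands parameter $\varphi_{\tilde\chi}:W_F\to\widehat T(\mathbb C)$ is characterized by $\nu(\varphi_{\tilde\chi}(z))=\tilde\chi(\nu(\tau_F(z)))$ for all $\nu\in X^*(\widehat T)=X_*(T)$ and $z\in W_F$. For $\chi\in T(k_F)^\vee$ and any extension $\tilde\chi$ to $T(F)$, the restriction $\varphi_\chi=\varphi_{\tilde\chi}|_{I_F}$ depends only on $\chi$. Fix $x\in I_F$ such that $\tau_F(x)\in\mathcal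 O_F^\times$ projects to a generator of $k_F^\times$. The endoscopic element associated to $\chi$ is $\kappa_\chi=\varphi_\chi(x)\in\widehat T(\mathbb C)$. *)

(* Defs.v *)
From HB Require Import structures.
From mathcomp Require Import all_boot all_order all_fingroup all_algebra all_field.
From mathcomp Require Import boolp reals complex.

Set Implicit Arguments.
Unset Strict Implicit.
Unset Printing Implicit Defensive.

Import Order.TTheory GRing.Theory Num.Theory.
Local Open Scope ring_scope.

Section Units.
Variable R : comUnitRingType.

Record units := Units { units_val :> R; _ : units_val \is a GRing.unit }.
HB.instance Definition _ := [isSub for units_val].
HB.instance Definition _ := [Choice of units by <:].
Implicit Types a b c : units.

Fact units_mul_subproof a b : val a * val b \is a GRing.unit.
Proof. by rewrite unitrM (valP a) (valP b). Qed.
Fact units_inv_subproof a : (val a)^-1 \is a GRing.unit.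
Proof. by rewrite unitrV (valP a). Qed.
Definition units_mul a b : units := Units (units_mul_subproof a b).
Definition units_inv a : units := Units (units_inv_subproof a).
Definition units_one : units := Units (unitr1 R).

Fact units_mulA : associative units_mul.
Proof. by move=> a b c; apply/val_inj; rewrite /= mulrA. Qed.
Fact units_mul1 : left_id units_one units_mul.
Proof. by move=> a; apply/val_inj; rewrite /= mul1r. Qed.
Fact units_mulr1 : right_id units_one units_mul.
Proof. by move=> a; apply/val_inj; rewrite /= mulr1. Qed.
Fact units_mulV : left_inverse units_one units_inv units_mul.
Proof. by move=> a; apply/val_inj; rewrite /= mulVr ?(valP a). Qed.
Fact units_mulrV : right_inverse units_one units_inv units_mul.
Proof. by move=> a; apply/val_inj; rewrite /= mulrV ?(valP a). Qed.
HB.instance Definition _ := isGroup.Build (units)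
  units_mulA units_mul1 units_mulr1 units_mulV units_mulrV.

Lemma val_unitsM a b : val (a * b)%g = val a * val b. Proof. by []. Qed.
Lemma units_mulgC a b : (a * b = b * a)%g.
Proof. by apply/val_inj; rewrite !val_unitsM mulrC. Qed.

Fact units_expz_subproof a (n : int) : val a ^ n \is a GRing.unit.
Proof. by rewrite unitrXz ?(valP a). Qed.
Definition units_expz a (n : int) : units :=
  Units (units_expz_subproof a n).
Lemma units_expzD a (m n : int) :
  units_expz a (m + n) = (units_expz a m * units_expz a n)%g.
Proof. by apply/val_inj; rewrite /= exprzDr ?(valP a). Qed.
End Units.

Section UnitsMap.
Variables (R S : comUnitRingType) (f : {rmorphism R -> S}).
Fact units_map_subproof (a : units R) : f (val a) \is a GRing.unit.
Proof. by rewrite rmorph_unit ?(valP a). Qed.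
Definition units_map a : units S := Units (units_map_subproof a).
Fact units_map_mul : {morph units_map : a b / (a * b)%g}.
Proof. by move=> a b; apply/val_inj; rewrite /= rmorphM. Qed.
HB.instance Definition _ := isMultiplicative.Build _ _ units_map units_map_mul.
End UnitsMap.

(* meant for finite G, where natural powers suffice *)
Definition generates (G : groupType) (g : G) : Prop :=
  forall y : G, exists n : nat, y = (g ^+ n)%g.

(* A field with a normalised discrete valuation; the value at 0 is junk. *)
Record dvField := DVField {
  dv_sort :> fieldType;
  dv : dv_sort -> int;
  dvM : forall x y, x != 0 -> y != 0 -> dv (x * y) = dv x + dv y;
  dvD : forall x y, x != 0 -> y != 0 -> x + y != 0 ->
          Num.min (dv x) (dv y) <= dv (x + y);
  dv_surj : exists x, (x != 0) && (dv x == 1) }.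

(* x lies in the n-th power of the maximal ideal *)
Definition dv_ge (F : dvField) (n : int) : {pred F} :=
  [pred x | (x == 0) || (n <= dv x)].
Arguments dv_ge F n : clear implicits.

Section Valuation.
Variable F : dvField.
Implicit Types x y : F.

Lemma dv1 : dv (1 : F) = 0.
Proof.
have := dvM (oner_neq0 F) (oner_neq0 F); rewrite mulr1 => /esym/eqP.
by rewrite -subr_eq0 addrK => /eqP.
Qed.

Lemma dvN x : x != 0 -> dv (- x) = dv x.
Proof.
move=> nz; have nz1 : (-1 : F) != 0 by rewrite oppr_eq0 oner_eq0.
have : dv (-1 : F) + dv (-1 : F) = 0 by rewrite -dvM // mulrNN mulr1 dv1.
rewrite -mulr2n => /eqP; rewrite mulrn_eq0 /= => /eqP v0.
by rewrite -mulN1r dvM // v0 add0r.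
Qed.

Lemma dvV x : x != 0 -> dv x^-1 = - dv x.
Proof.
move=> nz; apply/eqP; rewrite -addr_eq0.
by rewrite -dvM ?invr_eq0 // mulVf // dv1.
Qed.

Fact dv_ge0_subring : subring_closed (dv_ge F 0).
Proof.
split=> [|x y|x y]; rewrite !inE.
- by rewrite dv1 lexx orbT.
- have [->|nzx] := eqVneq x 0; have [->|nzy] := eqVneq y 0 => //=.
  + by rewrite subr0 eqxx.
  + by rewrite sub0r oppr_eq0 (negPf nzy) dvN.
  + by rewrite subr0 (negPf nzx).
  move=> vx vy; have [//|nzs] := eqVneq (x - y) 0; rewrite /=.
  apply: le_trans (dvD _ _ nzs) => //; last by rewrite oppr_eq0.
  by rewrite le_min vx dvN.
have [->|nzx] := eqVneq x 0; first by rewrite mul0r eqxx.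
have [->|nzy] := eqVneq y 0; first by rewrite mulr0 eqxx.
by move=> /= vx vy; rewrite dvM // addr_ge0 ?orbT.
Qed.
HB.instance Definition _ :=
  GRing.isSubringClosed.Build F (dv_ge F 0) dv_ge0_subring.

Record ringOfIntegers := RingOfIntegers {
  int_val :> F;
  int_valP : int_val \in dv_ge F 0 }.
HB.instance Definition _ := [isSub for int_val].
HB.instance Definition _ := [Choice of ringOfIntegers by <:].
HB.instance Definition _ :=
  [SubChoice_isSubComNzRing of ringOfIntegers by <:].
Implicit Types a b : ringOfIntegers.

Definition int_unit : {pred ringOfIntegers} :=
  [pred a | (val a != 0) && (dv (val a) == 0)].
Definition int_inv a : ringOfIntegers :=
  if int_unit a then insubd a (val a)^-1 else a.

Lemma int_unitE a : int_unit a = (val a != 0) && (dv (val a) == 0).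
Proof. by []. Qed.

Lemma val_int_inv a : int_unit a -> val (int_inv a) = (val a)^-1.
Proof.
move=> ua; rewrite /int_inv ua val_insubd.
by move: ua => /andP[nz /eqP v0]; rewrite inE dvV // v0 oppr0 lexx orbT.
Qed.

Fact int_mulVr : {in int_unit, left_inverse 1 int_inv *%R}.
Proof.
move=> a ua; apply/val_inj; rewrite rmorphM rmorph1 /= val_int_inv //.
by move: ua => /andP[nz _]; rewrite mulVf.
Qed.

Fact int_unitP a b : b * a = 1 -> int_unit a.
Proof.
move=> /(congr1 val); rewrite rmorphM rmorph1 /= => ba1.
have : val b * val a != 0 by rewrite ba1 oner_neq0.
rewrite mulf_eq0 negb_or => /andP[nzb nza]; rewrite int_unitE nza /=.
have := congr1 (@dv F) ba1; rewrite dvM // dv1 => v0.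
have vb : 0 <= dv (val b) by have := valP b; rewrite inE (negPf nzb).
have va : 0 <= dv (val a) by have := valP a; rewrite inE (negPf nza).
by move/eqP: v0; rewrite paddr_eq0 // => /andP[].
Qed.

Fact int_inv_out : {in [predC int_unit], int_inv =1 id}.
Proof.
move=> a nua; rewrite /int_inv; case: ifP => // ua.
by have := nua : ~~ int_unit a; rewrite ua.
Qed.

HB.instance Definition _ := GRing.ComNzRing_hasMulInverse.Build
  ringOfIntegers int_mulVr int_unitP int_inv_out.

Definition int_incl : ringOfIntegers -> F := val.
HB.instance Definition _ := GRing.RMorphism.on int_incl.
End Valuation.

Record localField := LocalField {
  lf_dv :> dvField;
  lf_complete : forall u : nat -> lf_dv,
    (forall n : nat, exists N : nat, forall i j : nat,
        (N <= i)%N -> (N <= j)%N -> u i - u j \in dv_ge lf_dv n%:Z) ->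
    exists l, forall n : nat, exists N : nat, forall i : nat,
        (N <= i)%N -> u i - l \in dv_ge lf_dv n%:Z;
  residueField : finFieldType;
  reduction : {rmorphism ringOfIntegers lf_dv -> residueField};
  reduction_surj : forall y, exists a, reduction a = y;
  reduction_ker : forall a, (reduction a == 0) = (val a \in dv_ge lf_dv 1) }.

Notation "''O_' F" := (ringOfIntegers F)
  (at level 8, F at level 2, format "''O_' F") : type_scope.
Notation "''k_' F" := (residueField F)
  (at level 8, F at level 2, format "''k_' F") : type_scope.

Record sepClosure (F : fieldType) := SepClosure {
  sc_sort :> fieldType;
  sc_in : {rmorphism F -> sc_sort};
  sc_algebraic : forall x : sc_sort,
    exists2 p : {poly F}, separable_poly p & root (map_poly sc_in p) x;
  sc_closed : forall p : {poly sc_sort},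
    separable_poly p -> (1 < size p)%N -> exists x, root p x }.

Record absGal (F : fieldType) (L : sepClosure F) := AbsGal {
  gal_fun :> {rmorphism L -> L};
  gal_bij : bijective gal_fun;
  gal_fix : forall a : F, gal_fun (sc_in L a) = sc_in L a }.

Section AbsGal.
Variables (F : fieldType) (L : sepClosure F).

Fact gal_mul_bij (s t : absGal L) : bijective (s \o t).
Proof. exact: bij_comp (gal_bij s) (gal_bij t). Qed.
Fact gal_mul_fix (s t : absGal L) (a : F) : (s \o t) (sc_in L a) = sc_in L a.
Proof. by rewrite /= !gal_fix. Qed.
Definition gal_mul (s t : absGal L) : absGal L :=
  AbsGal (gal_mul_bij s t) (gal_mul_fix s t).
End AbsGal.

Section Weil.
Variables (F : localField) (L : sepClosure F).

(* the valuation ring of L, i.e. the integral closure of 'O_F in L *)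
Definition sc_int (x : L) : Prop :=
  integralOver (sc_in L \o @int_incl F) x.

(* the maximal ideal of the valuation ring of L *)
Definition sc_max (x : L) : Prop :=
  sc_int x /\ (x != 0 -> ~ sc_int x^-1).

(* w acts on the residue field of L as the n-th power of the arithmetic      *)
(* Frobenius; for n < 0 the congruence is raised to the power q ^ (- n).     *)
Definition frobenius_degree (w : absGal L) (n : int) : Prop :=
  forall x : L, sc_int x ->
    match n with
    | Posz m => sc_max (w x - x ^+ (#|'k_F| ^ m))
    | Negz m => sc_max (w x ^+ (#|'k_F| ^ m.+1) - x)
    end.

Definition weil (w : absGal L) : Prop := exists n, frobenius_degree w n.

Definition inertia (w : absGal L) : Prop :=
  forall x : L, sc_int x -> sc_max (w x - x).

(* [tau] is only relevant on the Weil group. The norm condition, for E       *)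
(* ranging over the finite abelian extensions of F in L, and the             *)
(* normalisation determine [tau] on the Weil group. The boolean selects the  *)
(* normalisation: [false] sends arithmetic, [true] geometric Frobenius       *)
(* elements to uniformisers.                                                 *)
Record reciprocity (geometric : bool) (tau : absGal L -> units F) : Prop :=
  Reciprocity {
  rec_mul : forall s t, weil s -> weil t ->
    tau (gal_mul s t) = (tau s * tau t)%g;
  rec_surj : forall a, exists2 w, weil w & tau w = a;
  rec_frobenius : forall w n, frobenius_degree w n ->
    dv (val (tau w)) = if geometric then - n else n;
  rec_norm : forall (E : splittingFieldType F) (j : {rmorphism E -> L}),
    (forall a : F, j a%:A = sc_in L a) ->
    galois 1%AS {:E} -> abelian 'Gal({:E} / 1%AS) ->
    forall w, weil w ->
      (forall y : E, w (j y) = j y) <->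
      exists y : E, (val (tau w))%:A = galNorm 1%AS {:E} y }.
End Weil.

Section Dual.
Variable M : zmodType.

Definition dual := {additive M -> int}.
HB.instance Definition _ := gen_eqMixin dual.
HB.instance Definition _ := gen_choiceMixin dual.

Lemma dual_ext (f g : dual) : f =1 g -> f = g.
Proof.
case: f g => [f [[hf]]] [g [[hg]]] /= /funext fg; subst g.
by congr (GRing.Additive.Pack (GRing.Additive.Class _)); congr (_ _);
   exact: Prop_irrelevance.
Qed.

Definition dual_add (f g : dual) : dual := f \+ g.
Definition dual_opp (f : dual) : dual := \- f.
Definition dual_zero : dual := \0.
Fact dual_addA : associative dual_add.
Proof. by move=> f g h; apply: dual_ext => m /=; rewrite addrA. Qed.
Fact dual_addC : commutative dual_add.
Proof. by move=> f g; apply: dual_ext => m /=; rewrite addrC. Qed.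
Fact dual_add0 : left_id dual_zero dual_add.
Proof. by move=> f; apply: dual_ext => m /=; rewrite add0r. Qed.
Fact dual_addN : left_inverse dual_zero dual_opp dual_add.
Proof. by move=> f; apply: dual_ext => m /=; rewrite addNr. Qed.
HB.instance Definition _ := GRing.isZmodule.Build dual
  dual_addA dual_addC dual_add0 dual_addN.

Lemma dualDE (f g : dual) m : (f + g) m = f m + g m. Proof. by []. Qed.
End Dual.

(* A split torus T is given by its character lattice. *)
Record splitTorus := SplitTorus {
  chars :> zmodType;
  chars_basis : exists (r : nat) (e : 'I_r -> chars), forall m : chars,
    exists! c : {ffun 'I_r -> int}, m = \sum_(i < r) e i *~ c i }.

(* [torus M R] is the group Hom(M, units R) of R-points of the split torus *)
(* with character group M.                                                       *)
Section Torus.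
Variables (M : zmodType) (R : comUnitRingType).

Record torus := Torus {
  torus_fun :> M -> units R;
  torusD : forall m n, torus_fun (m + n) = (torus_fun m * torus_fun n)%g }.
HB.instance Definition _ := gen_eqMixin torus.
HB.instance Definition _ := gen_choiceMixin torus.
Implicit Types s t u : torus.

Lemma torus_ext s t : s =1 t -> s = t.
Proof.
case: s t => [s hs] [t ht] /= /funext st; subst t.
by congr Torus; exact: Prop_irrelevance.
Qed.

Fact torus_mul_subproof s t m n :
  (s (m + n) * t (m + n) = (s m * t m) * (s n * t n))%g.
Proof.
rewrite !torusD -!mulgA; congr (_ * _)%g.
by rewrite !mulgA; congr (_ * _)%g; exact: units_mulgC.
Qed.
Fact torus_inv_subproof t m n : ((t (m + n))^-1 = (t m)^-1 * (t n)^-1)%g.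
Proof. by rewrite torusD invgM units_mulgC. Qed.
Fact torus_one_subproof (m n : M) : (1 = 1 * 1 :> units R)%g.
Proof. by rewrite mulg1. Qed.
Definition torus_mul s t := Torus (torus_mul_subproof s t).
Definition torus_inv t := Torus (torus_inv_subproof t).
Definition torus_one := Torus torus_one_subproof.

Fact torus_mulA : associative torus_mul.
Proof. by move=> s t u; apply: torus_ext => m /=; rewrite mulgA. Qed.
Fact torus_mul1 : left_id torus_one torus_mul.
Proof. by move=> t; apply: torus_ext => m /=; rewrite mul1g. Qed.
Fact torus_mulr1 : right_id torus_one torus_mul.
Proof. by move=> t; apply: torus_ext => m /=; rewrite mulg1. Qed.
Fact torus_mulV : left_inverse torus_one torus_inv torus_mul.
Proof. by move=> t; apply: torus_ext => m /=; rewrite mulVg. Qed.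
Fact torus_mulrV : right_inverse torus_one torus_inv torus_mul.
Proof. by move=> t; apply: torus_ext => m /=; rewrite mulgV. Qed.
HB.instance Definition _ := isGroup.Build torus
  torus_mulA torus_mul1 torus_mulr1 torus_mulV torus_mulrV.

Lemma torusME s t m : (s * t)%g m = (s m * t m)%g. Proof. by []. Qed.
End Torus.

Section TorusMap.
Variables (M : zmodType) (R S : comUnitRingType).
Variable f : {multiplicative units R -> units S}.
Fact torus_map_subproof (t : torus M R) m n :
  f (t (m + n)) = (f (t m) * f (t n))%g.
Proof. by rewrite torusD gmulfM. Qed.
Definition torus_map (t : torus M R) : torus M S :=
  Torus (torus_map_subproof t).
Fact torus_map_mul : {morph torus_map : s t / (s * t)%g}.
Proof. by move=> s t; apply: torus_ext => m; exact: gmulfM. Qed.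
HB.instance Definition _ := isMultiplicative.Build _ _ torus_map torus_map_mul.
End TorusMap.

(* the point nu(a) *)
Section Cocharacter.
Variables (M : zmodType) (R : comUnitRingType).
Fact cochar_subproof (nu : dual M) (a : units R) m n :
  units_expz a (nu (m + n)) =
  (units_expz a (nu m) * units_expz a (nu n))%g.
Proof. by rewrite raddfD units_expzD. Qed.
Definition cochar (nu : dual M) (a : units R) : torus M R :=
  Torus (cochar_subproof nu a).
Lemma cocharD nu1 nu2 a :
  cochar (nu1 + nu2) a = (cochar nu1 a * cochar nu2 a)%g.
Proof.
by apply: torus_ext => m; exact: units_expzD.
Qed.
End Cocharacter.

Section Characters.
Variables (R : realType) (F : localField) (T : splitTorus).
Local Notation O := (ringOfIntegers F).
Local Notation k := (residueField F).
Local Notation Cx := (units R[i]).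

Definition torus_incl : torus T O -> torus T F :=
  torus_map (units_map (@int_incl F)).
Definition torus_red : torus T O -> torus T k :=
  torus_map (units_map (reduction F)).

(* [chi] is trivial on the n-th congruence subgroup of T(O) for some n *)
Definition smooth (chi : torus T O -> Cx) : Prop :=
  exists n : nat, forall t : torus T O,
    (forall m : T, val (val (t m)) - 1 \in dv_ge F n%:Z) -> chi t = 1%g.

Record depthZeroCharacter := DepthZeroCharacter {
  dzc :> {multiplicative torus T O -> Cx};
  dzc_smooth : smooth dzc;
  dzc_factor : exists chibar : {multiplicative torus T k -> Cx},
    forall t, dzc t = chibar (torus_red t) }.

(* Since T(O) is open in T(F), smoothness can be tested on T(O). *)
Record torusCharacter := TorusCharacter {
  tc :> {multiplicative torus T F -> Cx};
  tc_smooth : smooth (tc \o torus_incl) }.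

Definition extends (tchi : torusCharacter) (chi : depthZeroCharacter) : Prop :=
  forall t : torus T O, tchi (torus_incl t) = chi t.

(* the complex points of the dual torus, whose character group is X_*(T) *)
Definition dualTorus := torus (dual T) R[i].
HB.instance Definition _ := Group.on dualTorus.

(* The points of the dual torus being homomorphisms X_*(T) -> C^x, the       *)
(* defining property of the Langlands parameter is its value at each nu.     *)
Section LanglandsParam.
Variables (L : sepClosure F) (tau : absGal L -> units F).

Fact langlands_param_subproof (tchi : torusCharacter) w (nu1 nu2 : dual T) :
  tchi (cochar (nu1 + nu2) (tau w)) =
  (tchi (cochar nu1 (tau w)) * tchi (cochar nu2 (tau w)))%g.
Proof. by rewrite cocharD gmulfM. Qed.
Definition langlands_param (tchi : torusCharacter) (w : absGal L) : dualTorus :=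
  Torus (langlands_param_subproof tchi w).
End LanglandsParam.

(* Existence of extensions: F^x retracts onto the units of O along            *)
(* a |-> a / pi ^ (dv a), for a uniformiser pi.                              *)
Definition unif : F := xchoose (dv_surj F).
Fact unif_neq0 : unif != 0.
Proof. by have /andP[] := xchooseP (dv_surj F). Qed.
Fact dv_unif : dv unif = 1.
Proof. by have /andP[_ /eqP] := xchooseP (dv_surj F). Qed.

Fact dv_expz (x : F) (n : int) : x != 0 -> dv (x ^ n) = dv x * n.
Proof.
move=> nz; have dvX m : dv (x ^+ m) = dv x * m%:Z.
  elim: m => [|m IH]; first by rewrite expr0 dv1 mulr0.
  by rewrite exprS dvM ?expf_neq0 // IH intS mulrDr mulr1.
case: n => n; first exact: dvX.
by rewrite NegzE -exprnN dvV ?expf_neq0 // dvX mulrN.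
Qed.

Definition unit_part (a : units F) : F := val a * unif ^ (- dv (val a)).
Fact units_neq0 (a : units F) : val a != 0.
Proof. by rewrite -unitfE (valP a). Qed.
Fact unit_part_neq0 a : unit_part a != 0.
Proof. by rewrite mulf_neq0 ?units_neq0 // expfz_neq0 ?unif_neq0. Qed.
Fact dv_unit_part a : dv (unit_part a) = 0.
Proof.
rewrite dvM ?units_neq0 ?expfz_neq0 ?unif_neq0 // dv_expz ?unif_neq0 //.
by rewrite dv_unif mul1r subrr.
Qed.
Fact unit_part_int a : unit_part a \in dv_ge F 0.
Proof. by rewrite inE dv_unit_part lexx orbT. Qed.
Fact unit_part_unit a : RingOfIntegers (unit_part_int a) \is a GRing.unit.
Proof. by apply/andP; rewrite /= unit_part_neq0 dv_unit_part. Qed.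
Definition to_unit (a : units F) : units O := Units (unit_part_unit a).
Fact to_unitM : {morph to_unit : a b / (a * b)%g}.
Proof.
move=> a b; do 2 apply/val_inj; rewrite /= /unit_part /=.
rewrite dvM ?units_neq0 // opprD expfzDr ?unif_neq0 //.
by rewrite mulrACA.
Qed.
HB.instance Definition _ := isMultiplicative.Build _ _ to_unit to_unitM.

Fact dv_units (u : units O) : dv (val (val u)) = 0.
Proof. by have /andP[_ /eqP] := valP u. Qed.

Fact to_unitK (u : units O) : to_unit (units_map (@int_incl F) u) = u.
Proof.
do 2 apply/val_inj; rewrite /= /unit_part /= /int_incl.
by rewrite dv_units oppr0 mulr1.
Qed.

Section Extension.
Variable chi : depthZeroCharacter.
Definition ext_fun (t : torus T F) : Cx := chi (torus_map to_unit t).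
Fact ext_funM : {morph ext_fun : s t / (s * t)%g}.
Proof. by move=> s t; rewrite /ext_fun !gmulfM. Qed.
HB.instance Definition _ := isMultiplicative.Build _ _ ext_fun ext_funM.
Fact ext_funE t : ext_fun (torus_incl t) = chi t.
Proof. by congr (chi _); apply: torus_ext => m; exact: to_unitK. Qed.
Fact ext_fun_smooth : smooth (ext_fun \o torus_incl).
Proof.
have [n chin] := dzc_smooth chi.
by exists n => t tn; rewrite /= ext_funE chin.
Qed.
Lemma extension_exists : exists tchi : torusCharacter, extends tchi chi.
Proof. by exists (TorusCharacter ext_fun_smooth) => t; exact: ext_funE. Qed.
Definition extension : torusCharacter := sval (cid extension_exists).
Lemma extensionP : extends extension chi.
Proof. exact: (svalP (cid extension_exists)). Qed.
End Extension.

Section Endoscopic.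
Variables (L : sepClosure F) (tau : absGal L -> units F).

(* to be used on the inertia group, where it does not depend on the choice   *)
(* of an extension (lemma inertial_paramE)                                   *)
Definition inertial_param (chi : depthZeroCharacter) (w : absGal L) :=
  langlands_param tau (extension chi) w.

Lemma inertial_paramE chi (tchi : torusCharacter) geometric w :
  reciprocity geometric tau -> inertia w -> extends tchi chi ->
  inertial_param chi w = langlands_param tau tchi w.
Proof.
move=> rec inw ext; apply: torus_ext => nu /=.
have dv0 : dv (val (tau w)) = 0.
  have : frobenius_degree w 0 by move=> y /inw; rewrite /= expn0 expr1.
  by move/(rec_frobenius rec); case: geometric {rec}; rewrite ?oppr0.
have [u <-] : exists u, units_map (@int_incl F) u = tau w.
  exists (to_unit (tau w)); apply/val_inj.
  by rewrite /= /int_incl /= /unit_part dv0 oppr0 mulr1.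
have -> : cochar nu (units_map (@int_incl F) u) = torus_incl (cochar nu u).
  apply: torus_ext => m; apply/val_inj; rewrite /= -rmorphXz ?(valP u) //.
by rewrite (extensionP chi) ext.
Qed.

Definition endoscopic_element (x : absGal L) (chi : depthZeroCharacter) :
  dualTorus := inertial_param chi x.

(* the image of tau x in the residue field generates its unit group *)
Definition tame_generator (x : absGal L) : Prop :=
  exists2 u : units O, units_map (@int_incl F) u = tau x &
    generates (units_map (reduction F) u).
End Endoscopic.

Definition power_kernel (n : nat) (kappa : dualTorus) : Prop :=
  (kappa ^+ n)%g = 1%g.
End Characters.

(* Main.v *)
Require Import Defs.
From HB Require Import structures.
From mathcomp Require Import all_boot all_order all_fingroup all_algebra all_field.
From mathcomp Require Import cyclic.
From mathcomp Require Import boolp reals complex.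

(** Every point of T(k) has the form nu(u) for u a generator of k^x, and
    nu(u) = nu'(u) exactly when nu - nu' is divisible by q - 1.  Hence evaluation
    at the points nu(u) identifies the characters of T(k) with the homomorphisms
    X_*(T) -> C^x that are killed by q - 1; for u the reduction of tau(x) this is
    the map sending chi to its endoscopic element. *)

Set Implicit Arguments.
Unset Strict Implicit.
Unset Printing Implicit Defensive.

Import Order.TTheory GRing.Theory Num.Theory.
Local Open Scope ring_scope.

Lemma multiplicative1 (G H : groupType) (f : {multiplicative G -> H}) :
  f 1%g = 1%g.
Proof. by apply: (mulIg (f 1%g)); rewrite -gmulfM !mul1g. Qed.

Lemma multiplicativeX (G H : groupType) (f : {multiplicative G -> H}) n :
  {morph f : a / (a ^+ n)%g}.
Proof.
move=> a; elim: n => [|n IH]; first exact: multiplicative1.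
by rewrite !expgS gmulfM IH.
Qed.

Section TorusTheory.
Variables (M : zmodType) (R : comUnitRingType).
Implicit Types (s t : torus M R) (m : M).

Lemma torus0 t : t 0 = 1%g.
Proof.
by apply: (mulIg (t 0)); rewrite mul1g -torusD addr0.
Qed.

Lemma torusN t m : t (- m) = (t m)^-1%g.
Proof. by apply: (mulIg (t m)); rewrite mulVg -torusD addNr torus0. Qed.

Lemma torus_mulrn t m n : t (m *+ n) = (t m ^+ n)%g.
Proof.
elim: n => [|n IH]; first by rewrite mulr0n torus0.
by rewrite mulrS torusD IH expgS.
Qed.

Lemma torusXE t n m : (t ^+ n)%g m = (t m ^+ n)%g.
Proof. by elim: n => // n IH; rewrite !expgS torusME IH. Qed.

Lemma val_unitsX (a : units R) n : val (a ^+ n)%g = val a ^+ n.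
Proof. by elim: n => // n IH; rewrite expgS exprS val_unitsM IH. Qed.

Lemma units_expz_nat (a : units R) (n : nat) :
  units_expz a n%:Z = (a ^+ n)%g.
Proof. by apply/val_inj; rewrite val_unitsX. Qed.

Lemma units_expg_expz (a : units R) (z : int) n :
  (units_expz a z ^+ n)%g = units_expz (a ^+ n)%g z.
Proof.
by apply/val_inj; rewrite val_unitsX /= val_unitsX; exact: (exprzAC _ z n).
Qed.

Lemma units_expz1 (z : int) : units_expz (1%g : units R) z = 1%g.
Proof. by apply/val_inj; rewrite /= exp1rz. Qed.

Lemma torus_eq_basis (r : nat) (e : 'I_r -> M) s t :
  (forall m, exists c : {ffun 'I_r -> int}, m = \sum_(i < r) e i *~ c i) ->
  (forall i, s (e i) = t (e i)) -> s = t.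
Proof.
move=> he st; apply: torus_ext => m; have [c ->] := he m.
elim/big_ind: _ => [|x y sx sy|i _]; first by rewrite !torus0.
  by rewrite !torusD sx sy.
by case: (c i) => n; rewrite ?NegzE ?mulrNz ?torusN -pmulrn !torus_mulrn st.
Qed.

End TorusTheory.

Lemma dualMnE (M : zmodType) (f : dual M) n m : (f *+ n) m = f m *+ n.
Proof. by elim: n => // n IH; rewrite !mulrS dualDE IH. Qed.

(** Provides a basis of the character lattice with its dual basis of cocharacters. The coordinate
    functions are additive because coordinates are unique. *)
Lemma split_torus_coords (T : splitTorus) :
  exists (r : nat) (e : 'I_r -> T) (eps : 'I_r -> dual T),
    (forall m, exists c : {ffun 'I_r -> int}, m = \sum_(i < r) e i *~ c i) /\
    (forall i j, eps i (e j) = (i == j)%:Z).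
Proof.
have [r [e he]] := chars_basis T; exists r, e.
pose c m : {ffun 'I_r -> int} := sval (cid (he m)).
have cE m : m = \sum_(i < r) e i *~ c m i by case: (svalP (cid (he m))).
have cU m d : m = \sum_(i < r) e i *~ (d : {ffun _ -> int}) i -> c m = d.
  by case: (svalP (cid (he m))) => _; apply.
have cB i : zmod_morphism (c^~ i).
  move=> m n; rewrite (cU (m - n) [ffun i => c m i - c n i]) ?ffunE //.
  rewrite {1}(cE m) {1}(cE n) -sumrB; apply: eq_bigr => j _.
  by rewrite ffunE mulrzBr.
pose cA i := GRing.isZmodMorphism.Build T int (c^~ i) (cB i).
exists (fun i => HB.pack_for (dual T) (c^~ i) (cA i)).
split=> [m|i j /=]; first by exists (c m); exact: cE.
rewrite (cU (e j) [ffun i => (i == j)%:Z]) ?ffunE //.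
rewrite (bigD1 j) //= ffunE eqxx big1 ?addr0 // => k /negPf kj.
by rewrite ffunE kj.
Qed.

(** A point is determined by its values on a basis, and each value is a power of [u]; these
    exponents are the coordinates of [nu] in the dual basis. *)
Lemma torus_cochar_surj (T : splitTorus) (R : comUnitRingType) (u : units R)
    (t : torus T R) :
  generates u -> exists nu : dual T, t = cochar nu u.
Proof.
move=> gen; have [r [e [eps [he epsE]]]] := split_torus_coords T.
have [l lE] := choice (fun i => gen (t (e i))).
exists (\sum_(i < r) eps i *+ l i); apply: (torus_eq_basis he) => j /=.
have -> : (\sum_(i < r) eps i *+ l i : dual T) (e j) = l j :> int.
  have -> : (\sum_(i < r) eps i *+ l i : dual T) (e j) =
            \sum_(i < r) (eps i *+ l i) (e j).
    by elim/big_rec2: _ => // i x y _ <-; rewrite dualDE.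
  rewrite (bigD1 j) //= dualMnE epsE eqxx big1 ?addr0 ?natz // => i /negPf ij.
  by rewrite dualMnE epsE ij mul0rn.
by rewrite units_expz_nat.
Qed.

Section FiniteField.
Variable k : finFieldType.

Lemma units_expg_card (a : units k) : (a ^+ (#|k| - 1))%g = 1%g.
Proof.
apply/val_inj; rewrite val_unitsX /=.
have nz : val a != 0 by rewrite -unitfE (valP a).
(* Multiplying by [a] reduces the claim to [a ^ q = a], valid in a field with [q] elements. *)
apply: (mulfI nz); rewrite -exprS subn1 prednK ?mulr1 ?expf_card //.
by apply/card_gt0P; exists 0.
Qed.

Lemma generates_expz_eq1 (u : units k) (z : int) :
  generates u -> units_expz u z = 1%g -> ((#|k| - 1)%N %| z)%Z.
Proof.
move=> gen uz1; pose g : {unit k} := FinRing.Unit (valP u).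
(* The powers of [u] exhaust the unit group, so the order of [u] is exactly [q - 1]. *)
have og : #[g]%g = (#|k| - 1)%N.
  rewrite subn1 -card_finField_unit orderE; apply/eq_card => h; rewrite inE.
  have [n hn] := gen (Units (valP h)).
  apply/cycleP; exists n; apply/val_inj; rewrite FinRing.val_unitX /=.
  by have /(congr1 val) := hn; rewrite val_unitsX.
rewrite -og dvdzE absz_nat order_dvdn; apply/eqP/val_inj; rewrite FinRing.val_unitX.
have /(congr1 val) /= := uz1; case: z {uz1} => n /=; first by [].
(* A negative exponent is reduced to its absolute value by inverting both sides. *)
by move/(congr1 GRing.inv); rewrite NegzE -exprnN invrK invr1.
Qed.

End FiniteField.

(** The pointwise quotient is again additive, since integer division respects sums of multiples of
    [n]. *)
Lemma dual_divz (M : zmodType) (nu : dual M) (n : nat) :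
  (forall m, (n %| nu m)%Z) -> exists mu : dual M, nu = mu *+ n.
Proof.
move=> ndvd; pose f m := (nu m %/ n)%Z.
have fB : zmod_morphism f.
  move=> a b; apply/eqP; rewrite eq_sym subr_eq eq_sym /f; apply/eqP.
  by rewrite -divzDl // -raddfD subrK.
pose fA := GRing.isZmodMorphism.Build M int f fB.
exists (HB.pack_for (dual M) f fA); apply: dual_ext => m.
by rewrite dualMnE /= -mulr_natr natz divzK.
Qed.

(** The required equation serves as the definition of [chi], since every point is some [nu(u)]; the
    condition on [kappa] makes the value independent of [nu]. *)
Lemma torus_char_of_kernel (T : splitTorus) (k : finFieldType)
    (S : comUnitRingType) (u : units k) (kappa : torus (dual T) S) :
  generates u -> (kappa ^+ (#|k| - 1))%g = 1%g ->
  exists chi : {multiplicative torus T k -> units S},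
    forall nu, chi (cochar nu u) = kappa nu.
Proof.
move=> gen kq.
(* If [nu(u) = mu(u)], then [u ^ (nu m - mu m) = 1] for all [m], so [nu - mu] is [q - 1] times a
   cocharacter, and [kappa] is trivial on it. *)
have wd nu mu : cochar nu u = cochar mu u -> kappa nu = kappa mu.
  move=> eq_nu; have [m|d nuE] := @dual_divz _ (nu - mu) (#|k| - 1)%N.
    apply: (generates_expz_eq1 gen).
    have eq_m : units_expz u (nu m) = units_expz u (mu m).
      by have /(congr1 (fun s => torus_fun s m)) := eq_nu.
    rewrite dualDE units_expzD eq_m -units_expzD -dualDE subrr.
    exact/val_inj.
  rewrite -[nu](subrK mu) torusD nuE torus_mulrn -torusXE kq.
  by rewrite mul1g.
(* A discrete logarithm to base [u], chosen arbitrarily and so perhaps not additive; [wd] makes its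
   composite with [kappa] multiplicative. *)
pose lg (t : torus T k) := sval (cid (torus_cochar_surj t gen)).
have lgE t : t = cochar (lg t) u := svalP (cid (torus_cochar_surj t gen)).
pose f (t : torus T k) := kappa (lg t).
have fM : {morph f : s t / (s * t)%g}.
  by move=> s t; rewrite /f -torusD; apply: wd; rewrite cocharD -!lgE.
pose fA := isMultiplicative.Build _ _ f fM.
exists (HB.pack_for {multiplicative torus T k -> units S} f fA) => nu /=.
by apply: wd; rewrite -lgE.
Qed.

Section DepthZero.
Variables (R : realType) (F : localField) (T : splitTorus).

Lemma torus_map_cochar (S S' : comUnitRingType) (f : {rmorphism S -> S'})
    (nu : dual T) (u : units S) :
  torus_map (units_map f) (cochar nu u) = cochar nu (units_map f u).
Proof.
by apply: torus_ext => m; apply/val_inj; rewrite /= -rmorphXz ?(valP u).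
Qed.

Lemma depth_zero_inflation
    (chibar : {multiplicative torus T (residueField F) -> units R[i]}) :
  exists chi : depthZeroCharacter R F T,
    forall t, chi t = chibar (torus_red t).
Proof.
pose chi := chibar \o torus_map (units_map (reduction F)).
suff sm : smooth chi by exists (DepthZeroCharacter sm
  (ex_intro _ chibar (fun=> erefl))).
(* Level 1 suffices: the kernel of reduction on T(O) is the first congruence subgroup. *)
exists 1%N => t t1; rewrite /chi /=.
suff -> : torus_map (units_map (reduction F)) t = 1%g by rewrite multiplicative1.
apply: torus_ext => m; apply/val_inj/eqP; rewrite /= -subr_eq0.
by rewrite -(rmorph1 (reduction F)) -rmorphB reduction_ker /= t1.
Qed.

(** Since [tau x] comes from a unit of the ring of integers, [nu(tau x)] lies in T(O), where the
    chosen extension agrees with [chi]. *)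
Lemma endoscopic_elementE (L : sepClosure F) (tau : absGal L -> units F) x u
    (chi : depthZeroCharacter R F T) (nu : dual T) :
  units_map (@int_incl F) u = tau x ->
  endoscopic_element tau x chi nu = chi (cochar nu u).
Proof.
by move=> ux; rewrite /= -ux -torus_map_cochar (extensionP chi).
Qed.

End DepthZero.

Theorem proposition2p33 (R : realType) (F : localField) (T : splitTorus)
    (L : sepClosure F) (geometric : bool) (tau : absGal L -> units F)
    (x : absGal L)
    (Htau : reciprocity geometric tau)
    (Hx : inertia x) (Hgen : tame_generator tau x) :
  forall kappa : dualTorus R T,
    (exists chi : depthZeroCharacter R F T,
       kappa = endoscopic_element tau x chi) <->
    power_kernel (#|residueField F| - 1)%N kappa.
Proof.
move=> kappa; have [u ux gen] := Hgen; split=> [[chi ->]|kq].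
  (* Necessity: [chi] factors through T(k), where the reduction of [nu(u)] is killed by [q - 1]. *)
  apply: torus_ext => nu; rewrite torusXE (endoscopic_elementE _ _ ux).
  have [chibar ->] := dzc_factor chi.
  rewrite /torus_red torus_map_cochar -multiplicativeX.
  suff -> : (cochar nu (units_map (reduction F) u) ^+ (#|residueField F| - 1))%g
            = 1%g by rewrite multiplicative1.
  apply: torus_ext => m; rewrite torusXE /=.
  by rewrite units_expg_expz units_expg_card units_expz1.
(* Sufficiency: build the character on T(k) from [kappa], then inflate it to T(O). *)
have [chibar chibarE] := torus_char_of_kernel gen kq.
have [chi chiE] := depth_zero_inflation chibar.
exists chi; apply: torus_ext => nu; rewrite (endoscopic_elementE _ _ ux) chiE.
by rewrite /torus_red torus_map_cochar chibarE.
Qed.
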